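(* Let $\psi\colon\mathbb{R}^n\times\mathbb{R}^m\times\mathbb{R}_+\to\mathbb{R}^d$ be a basis satisfying Assumption A1 (stated in the context), let $H^\theta=\theta^\intercal\psi$ for $\theta\in\mathbb{R}^d$, fix $\sigma>0$ and $\mathcal{T}>0$, and let $\{(x_t,u_t):0\le t\le\mathcal{T}\}$ be a given input-state trajectory. Write $\psi_t=\psi(x_t,u_t,t)$. If the set $\{\psi_t:0\le t\le\mathcal{T}\}$ is not restricted to any half space in $\mathbb{R}^d$ (Condition E1), then both of the following hold: (E2) The only vector $v\in\mathbb{R}^d$ satisfying $$\underline{H}^v(x_{\mathcal{T}-r},\mathcal{T}-r)\ \ge\ \sigma\int_0^re^{-\sigma(r-s)}v^\intercal\psi_{\mathcal{T}-s}\,ds\qquad\text{for all }0\le r\le\mathcal{T}$$ is $v=0$. (E3) The matrix $$\Sigma=\frac1{\mathcal{T}}\int_0^{\mathcal{T}}\tilde\psi_s\tilde\psi_s^\intercal\,ds,\qquad\tilde\psi_s=\psi_s-\frac1{\mathcal{T}}\int_0^{\mathcal{T}}\psi_t\,dt,$$ is positive definite.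
   Context: The state equation is $\frac{d}{dt}x_t=F(x_t,u_t,t)$ with $x_t\in\mathbb{R}^n$, $u_t\in\mathbb{R}^m$; an input-state trajectory is a solution $(x_t,u_t)_{0\le t\le\mathcal{T}}$ with $u$ continuous. The cost function is $c\colon\mathbb{R}^n\times\mathbb{R}^m\times\mathbb{R}_+\to\mathbb{R}_+$. Assumption A1: The function class is linear, $\{H^\theta=\theta^\intercal\psi:\theta\in\mathbb{R}^d\}$. The basis $\psi$ and the cost function $c$ are continuously differentiable. Moreover, for each $\theta\in\mathbb{R}^d$, the minimum in $\phi^\theta(x,t)=\arg\min_uH^\theta(x,u,t)$ defines a continuous feedback law $\phi^\theta\colon\mathbb{R}^n\times\mathbb{R}_+\to\mathbb{R}^m$, and with $u_t=\phi^\theta(x_t,t)$ for $0\le t\le\mathcal{T}$ there is a solution to the state equation. Notation: $\underline{H}^v(x,t)=\min_{u\in\mathbb{R}^m}H^v(x,u,t)$. A half space in $\mathbb{R}^d$ means a closed half space with the origin on its boundary, $\{y\in\mathbb{R}^d:v^\intercal y\ge0\}$ with $v\ne0$; ''restricted to'' means ''contained in''. *)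

(* Defs.v *)
From HB Require Import structures.
From mathcomp Require Export all_boot all_order all_algebra.
From mathcomp Require Export all_classical all_reals all_analysis.

Set Implicit Arguments.
Unset Strict Implicit.
Unset Printing Implicit Defensive.

Export Order.TTheory GRing.Theory Num.Theory.
Export numFieldNormedType.Exports.

Local Open Scope classical_set_scope.
Local Open Scope ring_scope.

Section calculus.
Context {R : realType}.

(* Functions on [R^n x R^m x R_+] and on [R_+] are represented by functions
   defined for all real times; every hypothesis and every conclusion below
   only involves their values at times [0 <= t]. *)

(* Continuous differentiability on a set which, like [R^n x R^m x R_+], may
   contain boundary points: [Df p] is the differential at [p] relative to [D].
   On a convex set with nonempty interior it is unique, and at interior points
   it is the usual differential.  In finite dimension the continuity of [Df]
   amounts to that of [Df ^~ h] for each direction [h]. *)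
Definition continuously_differentiable_on (V W : normedModType R)
    (D : set V) (f : V -> W) : Prop :=
  exists Df : V -> {linear V -> W},
    (forall p, D p -> forall eps : R, 0 < eps ->
       \forall q \near within D (nbhs p),
         `|f q - f p - Df p (q - p)| <= eps * `|q - p|) /\
    (forall h, {within D, continuous (fun p => Df p h)}).

(* One-sided at the endpoints of the interval. *)
Definition has_derivative_within (V : normedModType R) (D : set R)
    (f : R -> V) (t : R) (l : V) : Prop :=
  (fun s => (s - t)^-1 *: (f s - f t)) @ within D t^' --> l.

Definition mx_integral (p q : nat) (D : set R) (f : R -> 'M[R]_(p, q)) :
    'M[R]_(p, q) :=
  \matrix_(i, j) \int[lebesgue_measure]_(s in D) f s i j.

Definition positive_definite (d : nat) (A : 'M[R]_d) : Prop :=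
  A^T = A /\ forall v : 'cV[R]_d, v != 0 -> 0 < (v^T *m A *m v) 0 0.

Definition argmin (U : Type) (f : U -> R) : set U :=
  [set u | forall w, f u <= f w].

(* The default value [0] is only used when the minimum is not attained. *)
Definition minimum (U : Type) (f : U -> R) : R := xget 0 (f @` argmin f).

Definition half_space (d : nat) (Y : set 'cV[R]_d) : Prop :=
  exists2 v : 'cV[R]_d, v != 0 & Y = [set y | 0 <= (v^T *m y) 0 0].

End calculus.

Section control.
Context {R : realType} {n m d : nat}.
Implicit Types (F : 'cV[R]_n -> 'cV[R]_m -> R -> 'cV[R]_n)
  (psi : 'cV[R]_n -> 'cV[R]_m -> R -> 'cV[R]_d)
  (c : 'cV[R]_n -> 'cV[R]_m -> R -> R)
  (x : R -> 'cV[R]_n) (u : R -> 'cV[R]_m) (T : R) (theta v : 'cV[R]_d).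

Definition solves_state_equation F T x u : Prop :=
  forall t : R, 0 <= t <= T ->
    has_derivative_within `[0, T] x t (F (x t) (u t) t).

Definition input_state_trajectory F T x u : Prop :=
  {within `[0, T], continuous u} /\ solves_state_equation F T x u.

Definition Hfun psi theta (z : 'cV[R]_n) (w : 'cV[R]_m) (t : R) : R :=
  (theta^T *m psi z w t) 0 0.

Definition Hmin psi theta (z : 'cV[R]_n) (t : R) : R :=
  minimum (fun w : 'cV[R]_m => Hfun psi theta z w t).

(* [phi] is a selection of the minimisers; they cannot be required to be
   unique, since [Hfun psi 0] vanishes identically. *)
Definition assumption_A1 F psi c T : Prop :=
  let D := [set p : 'cV[R]_n * 'cV[R]_m * R^o | 0 <= p.2] in
  [/\ continuously_differentiable_on D (fun p => psi p.1.1 p.1.2 p.2),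
      continuously_differentiable_on D
        (fun p => c p.1.1 p.1.2 p.2 : R^o) &
      forall theta, exists phi : 'cV[R]_n -> R -> 'cV[R]_m,
        [/\ {within [set p : 'cV[R]_n * R | 0 <= p.2],
               continuous (fun p => phi p.1 p.2)},
            forall (z : 'cV[R]_n) (t : R), 0 <= t ->
              argmin (fun w => Hfun psi theta z w t) (phi z t) &
            exists x, solves_state_equation F T x (fun t => phi (x t) t)]].

Definition psi_along psi x u (t : R) : 'cV[R]_d := psi (x t) (u t) t.

Definition condition_E1 psi x u T : Prop :=
  ~ exists Y : set 'cV[R]_d,
      half_space Y /\ psi_along psi x u @` `[0, T] `<=` Y.

Definition E2_inequality psi x u (sigma : R) T v : Prop :=
  forall r : R, 0 <= r <= T ->
    sigma * \int[lebesgue_measure]_(s in `[0, r])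
      (expR (- sigma * (r - s)) * (v^T *m psi_along psi x u (T - s)) 0 0)
    <= Hmin psi v (x (T - r)) (T - r).

Definition psi_centered psi x u T (s : R) : 'cV[R]_d :=
  psi_along psi x u s - T^-1 *: mx_integral `[0, T] (psi_along psi x u).

Definition Sigma_mx psi x u T : 'M[R]_d :=
  T^-1 *: mx_integral `[0, T]
    (fun s => psi_centered psi x u T s *m (psi_centered psi x u T s)^T).

End control.

(* Main.v *)
(* E2: along the trajectory, the left-hand side of the inequality is at most
   [g r = v^T psi_(T-r)], so [g] dominates its own exponentially discounted
   average.  A negative minimum of [g] is impossible, since the discounting
   weights have total mass [1 - exp (- sigma r) < 1]; hence [v^T psi_t >= 0] on
   [0, T], and E1 forces [v = 0].
   E3: [v^T Sigma v] is the time average of the square of the continuous function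
   [v^T psi_s] minus its mean.  If it vanished, [v^T psi] would be constant, so
   one of [v], [- v] would define a half space containing the trajectory. *)
From HB Require Import structures.
Require Import Defs.
From mathcomp Require Import ring lra.

Set Implicit Arguments.
Unset Strict Implicit.
Unset Printing Implicit Defensive.

Local Open Scope classical_set_scope.
Local Open Scope ring_scope.

(** * Continuity relative to a subset *)

Lemma within_continuous_comp_in (U V W : topologicalType) (D : set U)
    (E : set V) (g : U -> V) (f : V -> W) :
  (forall t, D t -> E (g t)) -> {within D, continuous g} ->
  {within E, continuous f} -> {within D, continuous (f \o g)}.
Proof.
move=> DE /subspace_continuousP cg /subspace_continuousP cf.
apply/subspace_continuousP => t Dt.
apply: cvg_comp (cf _ (DE _ Dt)) => P; rewrite /within/= => EP.
have DD : within D (nbhs t) D by exact: withinT.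
apply: filterS2 DD (cg t Dt _ EP) => s Ds EPs; apply: EPs; exact: DE.
Qed.

Lemma within_continuous_pair (U V W : topologicalType) (D : set U)
    (f : U -> V) (g : U -> W) :
  {within D, continuous f} -> {within D, continuous g} ->
  {within D, continuous (fun t => (f t, g t))}.
Proof.
move=> /subspace_continuousP cf /subspace_continuousP cg.
apply/subspace_continuousP => t Dt.
exact: (@cvg_pair _ _ _ (within D (nbhs t)) (nbhs (f t)) (nbhs (g t)) _ _ _
  f g (cf t Dt) (cg t Dt)).
Qed.

(** * Linear maps in finite dimension; differentiability implies continuity *)

Section linear_continuity.
Context {R : realType}.

(** A linear map out of a matrix space is a finite sum of coordinates times fixed vectors. This
    matters because [continuously_differentiable_on] asks the differential only to be linear. *)
Lemma linear_mx_continuous (p q : nat) (W : normedModType R)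
    (L : {linear 'M[R]_(p, q) -> W}) : continuous L.
Proof.
have -> : L = (fun A : 'M[R]_(p, q) =>
    \sum_i \sum_j A i j *: L (delta_mx i j)) :> (_ -> _).
  apply/funext => A; rewrite {1}(matrix_sum_delta A) linear_sum.
  apply: eq_bigr => i _; rewrite linear_sum.
  by apply: eq_bigr => j _; rewrite linearZ.
apply: continuous_big => [|i _]; first exact: add_continuous.
apply: continuous_big => [|j _]; first exact: add_continuous.
move=> A; apply: (@cvgZr_tmp _ _ _ (nbhs A) _ (fun B : 'M[R]_(p, q) => B i j)).
exact: coord_continuous.
Qed.

(** [L] splits as a linear map of each component. Automatic continuity is a hypothesis on each
    factor, so the lemma can be iterated to reach the product of states, inputs and times. *)
Lemma linear_pair_continuous (U V W : normedModType R)
    (L : {linear (U * V)%type -> W}) :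
  (forall K : {linear U -> W}, continuous K) ->
  (forall K : {linear V -> W}, continuous K) -> continuous L.
Proof.
move=> cU cV.
pose L1 (a : U) := L (a, 0); pose L2 (b : V) := L (0, b).
have l1 : linear L1.
  move=> k a b; rewrite /L1 -linearP; congr (L _).
  by congr pair; rewrite /= scaler0 addr0.
have l2 : linear L2.
  move=> k a b; rewrite /L2 -linearP; congr (L _).
  by congr pair; rewrite /= scaler0 addr0.
pose L1' : {linear U -> W} := HB.pack L1 (GRing.isLinear.Build _ _ _ _ _ l1).
pose L2' : {linear V -> W} := HB.pack L2 (GRing.isLinear.Build _ _ _ _ _ l2).
have -> : L = (fun p => L1' p.1 + L2' p.2) :> (_ -> _).
  apply/funext => -[a b]; rewrite /= /L1 /L2 -linearD; congr (L _).
  by congr pair; rewrite /= ?addr0 ?add0r.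
move=> p; apply: cvgD.
  by apply: (@continuous_comp _ _ _ fst L1'); [exact: cvg_fst|exact: cU].
by apply: (@continuous_comp _ _ _ snd L2'); [exact: cvg_snd|exact: cV].
Qed.

Lemma linear_scalar_continuous (W : normedModType R) (L : {linear R^o -> W}) :
  continuous L.
Proof.
have -> : L = (fun a : R => a *: L 1) :> (_ -> _).
  by apply/funext => a; rewrite -linearZ/= /GRing.scale/= mulr1.
by move=> a; apply: cvgZr_tmp; exact: cvg_id.
Qed.

Lemma continuously_differentiable_within_continuous (V W : normedModType R)
    (D : set V) (f : V -> W) :
  (forall L : {linear V -> W}, continuous L) ->
  continuously_differentiable_on D f -> {within D, continuous f}.
Proof.
move=> cL [Df [dDf _]]; apply/subspace_continuousP => p Dp.
apply/cvgrPdist_le => e e0.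
have e20 : 0 < e / 2 by rewrite divr_gt0.
near=> q.
(* The increment of [f] is split into the Taylor remainder, bounded by [|q - p|] (tolerance 1), and
   the linear term; each is at most [e / 2] near [p]. *)
rewrite distrC -[X in `|X|](subrK (Df p (q - p))).
rewrite (le_trans (ler_normD _ _))// [leRHS]splitr lerD//.
  apply: (@le_trans _ _ (1 * `|q - p|)).
    by near: q; exact: dDf.
  rewrite mul1r distrC; near: q; apply: cvg_within.
  by move: (e / 2) e20; apply/cvgrPdist_le; exact: cvg_id.
rewrite linearB/= distrC; near: q; apply: cvg_within.
by move: (e / 2) e20; apply/cvgrPdist_le; exact: cL.
Unshelve. all: by end_near. Qed.

Lemma has_derivative_within_continuous (V : normedModType R) (D : set R)
    (f f' : R -> V) :
  (forall t, D t -> has_derivative_within D f t (f' t)) ->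
  {within D, continuous f}.
Proof.
move=> df; apply/subspace_continuousP => t Dt.
have {}df := df t Dt.
(* For [s != t] this expression equals [f s], and its limit is [f t] since the difference quotient
   converges while [s - t] vanishes. *)
have : (fun s => f t + (s - t) *: ((s - t)^-1 *: (f s - f t)))
    @ within D t^' --> f t + (t - t) *: f' t.
  apply: cvgD; first exact: cvg_cst.
  apply: cvgZ df.
  apply: cvgB; last exact: cvg_cst.
  apply: cvg_trans (@cvg_id _ (nbhs t)).
  apply: cvg_trans (@nbhs_dnbhs _ t).
  exact: cvg_within.
rewrite subrr scale0r addr0 => cf P fP.
(* The limit is along a punctured neighbourhood; the missing point [s = t] is added by hand
   below. *)
have cfP : nbhs t (fun s => s != t -> D s ->
    P (f t + (s - t) *: ((s - t)^-1 *: (f s - f t)))) by exact: cf P fP.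
suff : nbhs t (fun s => D s -> P (f s)) by [].
apply: filterS cfP => s sP Ds.
have [->|st] := eqVneq s t; first exact: nbhs_singleton.
have := sP st Ds; rewrite scalerA mulfV ?subr_eq0// scale1r.
by rewrite addrC subrK.
Qed.
End linear_continuity.

(** * Integrals of continuous functions on a segment *)

Section integrals.
Context {R : realType}.
Local Notation mu := (@lebesgue_measure R).

Lemma within_continuous_integrable (a b : R) (f : R -> R) :
  {within `[a, b], continuous f} -> mu.-integrable `[a, b] (EFin \o f).
Proof.
by move=> cf; apply: continuous_compact_integrable => //; exact: segment_compact.
Qed.

Lemma Rintegral_sum (D : set R) (I : Type) (r : seq I) (f : I -> R -> R) :
  measurable D -> (forall i, mu.-integrable D (EFin \o f i)) ->
  \int[mu]_(s in D) (\sum_(i <- r) f i s) =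
    \sum_(i <- r) \int[mu]_(s in D) f i s.
Proof.
move=> mD intf; elim: r => [|i r IH].
  rewrite big_nil; under eq_Rintegral do rewrite big_nil.
  by rewrite Rintegral_cst// mul0r.
rewrite big_cons -IH; under eq_Rintegral do rewrite big_cons.
rewrite RintegralD//.
rewrite (_ : EFin \o _ = fun s => \sum_(j <- r) (f j s)%:E)%E; last first.
  by apply/funext => s /=; rewrite sumEFin.
by apply: integrable_sum => // j _; exact: intf.
Qed.

Lemma mulmx_mx_integral (a b : R) (k p q : nat) (A : 'M[R]_(k, p))
    (M : R -> 'M[R]_(p, q)) :
  (forall i j, {within `[a, b], continuous (fun s => M s i j)}) ->
  A *m mx_integral `[a, b] M = mx_integral `[a, b] (fun s => A *m M s).
Proof.
move=> cM; apply/matrixP => i j; rewrite !mxE.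
transitivity (\sum_l \int[mu]_(s in `[a, b]) (A i l * M s l j)).
  apply: eq_bigr => l _; rewrite mxE RintegralZl//.
  exact: within_continuous_integrable.
rewrite -Rintegral_sum//; last first.
  move=> l; apply: within_continuous_integrable => s.
  by apply: cvgM; [exact: cvg_cst|exact: cM].
by apply: eq_Rintegral => s _; rewrite mxE.
Qed.

Lemma trmx_mx_integral (D : set R) (p q : nat) (M : R -> 'M[R]_(p, q)) :
  (mx_integral D M)^T = mx_integral D (fun s => (M s)^T).
Proof.
by apply/matrixP => i j; rewrite !mxE; apply: eq_Rintegral => s _; rewrite mxE.
Qed.

Lemma mx_integral_mulmx (a b : R) (k p q : nat) (A : 'M[R]_(q, k))
    (M : R -> 'M[R]_(p, q)) :
  (forall i j, {within `[a, b], continuous (fun s => M s i j)}) ->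
  mx_integral `[a, b] M *m A = mx_integral `[a, b] (fun s => M s *m A).
Proof.
move=> cM; apply: trmx_inj; rewrite trmx_mul !trmx_mx_integral.
rewrite mulmx_mx_integral => [|i j].
  by congr mx_integral; apply/funext => s; rewrite trmx_mul.
have -> : (fun s => (M s)^T i j) = (fun s => M s j i); last exact: cM.
by apply/funext => s; rewrite mxE.
Qed.

(** By continuity [f] stays above [f t / 2] on a nondegenerate interval near [t], and dropping the
    rest of the segment only lowers the integral. *)
Lemma Rintegral_gt0 (a b t : R) (f : R -> R) : a < b ->
  {within `[a, b], continuous f} -> (forall s, a <= s <= b -> 0 <= f s) ->
  a <= t <= b -> 0 < f t -> 0 < \int[mu]_(s in `[a, b]) f s.
Proof.
move=> ab cf f0 /andP[at_ tb] ft.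
have [e /= e0 fe] : exists2 e, 0 < e &
    forall s, `|t - s| < e -> a <= s <= b -> f t / 2 <= f s.
  move/subspace_continuousP/(_ t) : cf.
  rewrite /= in_itv/= at_ tb => /(_ isT)/cvgrPdist_le/(_ (f t / 2)).
  rewrite divr_gt0// => /(_ isT) [e /= e0 H]; exists e => // s /H/[swap] sab.
  rewrite in_itv/= => /(_ sab); rewrite ler_distlC => /andP[h _].
  by move: h; rewrite /from_subspace; lra.
(* Clipping to the segment covers the case where [t] is an endpoint; [a < b] keeps the length
   positive. The radius [e / 2] keeps the closed interval inside the open ball of radius [e]. *)
pose l := Num.max a (t - e / 2); pose r := Num.min b (t + e / 2).
have lr : l < r.
  rewrite /l /r gt_max !lt_min ab/=; lra.
have lrab : `[l, r] `<=` `[a, b].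
  apply: subset_itv; rewrite bnd_simp; first by rewrite le_max lexx.
  by rewrite ge_min lexx.
have iab := within_continuous_integrable cf.
have ilr : mu.-integrable `[l, r] (EFin \o f) by exact: integrableS iab.
apply: (@lt_le_trans _ _ (\int[mu]_(s in `[l, r]) (f t / 2))).
  rewrite Rintegral_cst//= lebesgue_measure_itv/= lte_fin lr/=.
  by rewrite mulr_gt0 ?divr_gt0 ?subr_gt0.
apply: (@le_trans _ _ (\int[mu]_(s in `[l, r]) f s)).
  apply: le_Rintegral => //.
    by apply: within_continuous_integrable => s; exact: cvg_cst.
  move=> s /[dup] /lrab; rewrite /= !in_itv/= => sab.
  rewrite /l /r ge_max le_min => /andP[/andP[_ h1] /andP[_ h2]].
  by apply: fe => //; rewrite ltr_norml; lra.
rewrite /Rintegral fine_le//.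
- exact: integrable_fin_num.
- exact: integrable_fin_num.
- apply: ge0_subset_integral => //.
  exact: (measurable_int mu).
Qed.

(** The weight [G] satisfies [G' = sigma G], so the fundamental theorem of calculus gives
    [G r - G 0]. *)
Lemma Rintegral_expR_discount (sigma r : R) : 0 < r ->
  sigma * \int[mu]_(s in `[0, r]) expR (- sigma * (r - s)) =
    1 - expR (- sigma * r).
Proof.
move=> r0; pose G (s : R) := expR (- sigma * (r - s)).
have dG (s : R) : is_derive s 1 G (sigma * G s).
  apply: is_derive_eq.
  rewrite /GRing.scale/= /G; ring.
have cG : continuous G.
  by move=> t; apply: differentiable_continuous; apply/derivable1_diffP.
have cG' (D : set R) : {within D, continuous G} by apply: continuous_subspaceT.
rewrite -RintegralZl//; last exact: within_continuous_integrable.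
rewrite /Rintegral (@continuous_FTC2 _ (fun s => sigma * G s) G)//.
- by rewrite /G/= subrr mulr0 expR0 subr0.
- by apply: continuous_subspaceT => s; apply: cvgM; [exact: cvg_cst|exact: cG].
- split.
  + by move=> s _; exact: (@ex_derive _ _ _ _ _ _ _ (dG s)).
  + by apply: cvg_at_right_filter; exact: cG.
  + by apply: cvg_at_left_filter; exact: cG.
- by move=> s _; rewrite derive1E; exact: (@derive_val _ _ _ _ _ _ _ (dG s)).
Qed.

(* At a minimiser [r] of [g], the discounted average is at least
   [(1 - exp (- sigma r)) g r], which exceeds [g r] when [g r < 0]. *)
Lemma ge_discounted_average_ge0 (sigma T : R) (g : R -> R) :
  0 < sigma -> 0 <= T -> {within `[0, T], continuous g} ->
  (forall r, 0 <= r <= T ->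
    sigma * \int[mu]_(s in `[0, r]) (expR (- sigma * (r - s)) * g s) <= g r) ->
  forall r, 0 <= r <= T -> 0 <= g r.
Proof.
move=> sigma0 T0 cg gE.
have [c cT cmin] := EVT_min T0 cg.
suff gc0 : 0 <= g c by move=> r rT; rewrite (le_trans gc0)// cmin.
move: (cT); rewrite in_itv/= => /[dup] c0T /andP[c0 cT'].
rewrite leNgt; apply/negP => gc.
have := gE c c0T; apply/negP; rewrite -ltNge.
(* At [c = 0] the integral is over a point and vanishes, so [g c < 0] is already the contradiction;
   the mass formula needs [0 < c]. *)
have [c00|cn0] := eqVneq c 0.
  by move: gc; rewrite c00 set_itv1 Rintegral_set1 mulr0.
have cp : 0 < c by rewrite lt_neqAle eq_sym cn0.
have cE : {within `[0, c], continuous (fun s => expR (- sigma * (c - s)))}.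
  apply: continuous_subspaceT => s.
  apply: continuous_comp; last exact: continuous_expR.
  by apply: cvgM; [exact: cvg_cst|apply: cvgB; [exact: cvg_cst|exact: cvg_id]].
have cg' : {within `[0, c], continuous g}.
  by apply: continuous_subspaceW cg; apply: subset_itvl; rewrite bnd_simp.
apply: (@lt_le_trans _ _ ((1 - expR (- sigma * c)) * g c)).
  by rewrite mulrBl mul1r ltrBrDl gtrDr pmulr_rlt0 ?expR_gt0.
rewrite -Rintegral_expR_discount// -mulrA ler_pM2l// -RintegralZr//; last first.
  exact: within_continuous_integrable.
apply: le_Rintegral => //.
- apply: within_continuous_integrable => s.
  by apply: cvgM; [exact: cE|exact: cvg_cst].
- apply: within_continuous_integrable => s.
  by apply: cvgM; [exact: cE|exact: cg'].
- move=> s; rewrite /= in_itv/= => /andP[s0 sc].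
  by rewrite ler_pM2l ?expR_gt0// cmin// in_itv/= s0 (le_trans sc).
Qed.

End integrals.

(** * The two conclusions along a trajectory *)

Section trajectory.
Context {R : realType} {n m d : nat}.
Local Notation mu := (@lebesgue_measure R).

(** The minimiser [u0] ensures that [minimum f] is an attained value, not the default 0. *)
Lemma minimum_le (U : Type) (f : U -> R) (u0 : U) : argmin f u0 ->
  forall w, minimum f <= f w.
Proof.
move=> fu0; have [u1 fu1 <-] : (f @` argmin f) (minimum f).
  by apply: xgetPex; exists (f u0), u0.
exact: fu1.
Qed.

Lemma psi_along_continuous (F : 'cV[R]_n -> 'cV[R]_m -> R -> 'cV[R]_n)
    (psi : 'cV[R]_n -> 'cV[R]_m -> R -> 'cV[R]_d) (T : R)
    (x : R -> 'cV[R]_n) (u : R -> 'cV[R]_m) :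
  continuously_differentiable_on
    [set p : 'cV[R]_n * 'cV[R]_m * R^o | 0 <= p.2]
    (fun p => psi p.1.1 p.1.2 p.2) ->
  input_state_trajectory F T x u ->
  {within `[0, T], continuous (psi_along psi x u)}.
Proof.
move=> cpsi [cu dx].
have cx : {within `[0, T], continuous x}.
  apply: (@has_derivative_within_continuous _ _ _ _ (fun t => F (x t) (u t) t)).
  by move=> t; rewrite /= in_itv/=; exact: dx.
(* [psi] is evaluated along the curve of state, input and time, which stays in the region of
   nonnegative times. *)
apply: (@within_continuous_comp_in _ _ _ _ _
    (fun t : R => ((x t, u t), t : R^o)) _ _ _
    (continuously_differentiable_within_continuous _ cpsi)).
- by move=> t; rewrite /= in_itv/= => /andP[].
- apply: within_continuous_pair; first exact: within_continuous_pair.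
  by apply: continuous_subspaceT => t; exact: cvg_id.
- move=> L; apply: linear_pair_continuous => K.
    by apply: linear_pair_continuous => J; exact: linear_mx_continuous.
  exact: linear_scalar_continuous.
Qed.

(** A nonzero [v] would be the normal of a half space containing the trajectory of [psi]. Both
    conclusions use E1 in this form. *)
Lemma condition_E1_ge0 (psi : 'cV[R]_n -> 'cV[R]_m -> R -> 'cV[R]_d) (T : R)
    (x : R -> 'cV[R]_n) (u : R -> 'cV[R]_m) (v : 'cV[R]_d) :
  condition_E1 psi x u T ->
  (forall t, 0 <= t <= T -> 0 <= (v^T *m psi_along psi x u t) 0 0) -> v = 0.
Proof.
move=> E1 v0; apply/eqP/negPn/negP => vn0; apply: E1.
exists [set y | 0 <= (v^T *m y) 0 0]; split; first by exists v.
by move=> _ [t /= + <-]; rewrite in_itv/=; exact: v0.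
Qed.

Lemma within_continuous_mulmx_coord (p q r : nat) (D : set R)
    (A : 'M[R]_(p, q)) (Y : R -> 'M[R]_(q, r)) i j :
  {within D, continuous Y} -> {within D, continuous (fun t => (A *m Y t) i j)}.
Proof.
move=> cY t.
apply: (@continuous_comp _ _ _ (Y : subspace D -> _) (fun B => (A *m B) i j)).
  exact: cY.
apply: (@continuous_comp _ _ _ (mulmx A) (fun B : 'M[R]_(p, r) => B i j)).
  exact: linear_mx_continuous.
exact: coord_continuous.
Qed.

(** With [v = 0] every input is a minimiser with value 0, so both sides of the inequality vanish. *)
Lemma E2_inequality0 (psi : 'cV[R]_n -> 'cV[R]_m -> R -> 'cV[R]_d)
    (x : R -> 'cV[R]_n) (u : R -> 'cV[R]_m) (sigma T : R) :
  E2_inequality psi x u sigma T 0.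
Proof.
move=> r rT; rewrite (_ : Hmin _ _ _ _ = 0); last first.
  have H0 w : Hfun psi 0 (x (T - r)) w (T - r) = 0.
    by rewrite /Hfun trmx0 mul0mx mxE.
  have [w _ <-] : (Hfun psi 0 (x (T - r)) ^~ (T - r) @`
      argmin (Hfun psi 0 (x (T - r)) ^~ (T - r))) (Hmin psi 0 (x (T - r)) (T - r)).
    by apply: xgetPex; exists 0, 0 => // w; rewrite !H0.
  exact: H0.
rewrite (@eq_Rintegral _ _ _ mu _ (fun _ => 0)).
  by rewrite Rintegral_cst// mul0r mulr0.
by move=> s _; rewrite trmx0 mul0mx mxE mulr0.
Qed.

Lemma E2_inequality_ge0 (psi : 'cV[R]_n -> 'cV[R]_m -> R -> 'cV[R]_d)
    (x : R -> 'cV[R]_n) (u : R -> 'cV[R]_m) (sigma T : R) (v : 'cV[R]_d) :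
  0 < sigma -> 0 <= T -> {within `[0, T], continuous (psi_along psi x u)} ->
  (forall z t, 0 <= t -> argmin (fun w => Hfun psi v z w t) !=set0) ->
  E2_inequality psi x u sigma T v ->
  forall t, 0 <= t <= T -> 0 <= (v^T *m psi_along psi x u t) 0 0.
Proof.
move=> sigma0 T0 cpsi attained E2 t tT.
(* Reversing time makes the integrand of E2 the discounted [g]. *)
pose g r := (v^T *m psi_along psi x u (T - r)) 0 0.
have -> : (v^T *m psi_along psi x u t) 0 0 = g (T - t).
  by rewrite /g opprB addrC subrK.
apply: (@ge_discounted_average_ge0 _ sigma T) => //; last lra.
  apply: (@within_continuous_comp_in _ _ _ _ `[0, T] (fun r => T - r)
    (fun r => (v^T *m psi_along psi x u r) 0 0)).
  - by move=> r; rewrite /= !in_itv/=; lra.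
  - apply: continuous_subspaceT => r.
    by apply: cvgB; [exact: cvg_cst|exact: cvg_id].
  - exact: within_continuous_mulmx_coord.
(* The minimum over inputs is at most the value at the actual input [u (T - r)], which is [g r]. *)
move=> r rT; rewrite (le_trans (E2 r rT))//.
have [|w argw] := attained (x (T - r)) (T - r); first lra.
exact: (minimum_le argw).
Qed.

Lemma Sigma_mx_sym (psi : 'cV[R]_n -> 'cV[R]_m -> R -> 'cV[R]_d)
    (x : R -> 'cV[R]_n) (u : R -> 'cV[R]_m) (T : R) :
  (Sigma_mx psi x u T)^T = Sigma_mx psi x u T.
Proof.
rewrite linearZ/= trmx_mx_integral; congr (_ *: mx_integral _ _).
by apply/funext => s; rewrite trmx_mul trmxK.
Qed.

Lemma Sigma_mx_quadratic (psi : 'cV[R]_n -> 'cV[R]_m -> R -> 'cV[R]_d)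
    (x : R -> 'cV[R]_n) (u : R -> 'cV[R]_m) (T : R) (v : 'cV[R]_d) :
  {within `[0, T], continuous (psi_along psi x u)} ->
  (v^T *m Sigma_mx psi x u T *m v) 0 0 =
  T^-1 * \int[mu]_(s in `[0, T]) ((v^T *m psi_centered psi x u T s) 0 0) ^+ 2.
Proof.
move=> cpsi.
have cY i j : {within `[0, T], continuous (fun s => psi_centered psi x u T s i j)}.
  rewrite (_ : (fun s => _) = fun s => (1%:M *m psi_centered psi x u T s) i j).
    apply: within_continuous_mulmx_coord => s.
    by apply: cvgB; [exact: cpsi|exact: cvg_cst].
  by apply/funext => s; rewrite mul1mx.
have cM i j : {within `[0, T], continuous (fun s =>
    (psi_centered psi x u T s *m (psi_centered psi x u T s)^T) i j)}.
  rewrite (_ : (fun s => _) = fun s =>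
    psi_centered psi x u T s i 0 * psi_centered psi x u T s j 0).
    by move=> s; apply: cvgM; exact: cY.
  by apply/funext => s; rewrite !mxE big_ord1 !mxE.
rewrite -scalemxAr -scalemxAl mxE; congr (_ * _).
rewrite -mulmxA mx_integral_mulmx// mulmx_mx_integral => [|i j]; last first.
  rewrite (_ : (fun s => _) = fun s => \sum_k
    (psi_centered psi x u T s *m (psi_centered psi x u T s)^T) i k * v k j).
    apply: continuous_big => [|k _]; first exact: add_continuous.
    by move=> s; apply: cvgM; [exact: cM|exact: cvg_cst].
  by apply/funext => s; rewrite mxE.
rewrite mxE; apply: eq_Rintegral => s _.
(* Regrouped, the integrand is a 1 by 1 matrix times its own transpose, hence a square. *)
rewrite -(mulmxA _ _ v) (mulmxA v^T).
have -> : (psi_centered psi x u T s)^T *m v =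
    (v^T *m psi_centered psi x u T s)^T by rewrite trmx_mul trmxK.
by rewrite [LHS]mxE big_ord1 [X in _ * X]mxE expr2.
Qed.

Lemma Sigma_mx_positive_definite
    (psi : 'cV[R]_n -> 'cV[R]_m -> R -> 'cV[R]_d)
    (x : R -> 'cV[R]_n) (u : R -> 'cV[R]_m) (T : R) :
  0 < T -> {within `[0, T], continuous (psi_along psi x u)} ->
  condition_E1 psi x u T -> positive_definite (Sigma_mx psi x u T).
Proof.
move=> T0 cpsi E1; split=> [|v vn0]; first exact: Sigma_mx_sym.
pose f s := (v^T *m psi_centered psi x u T s) 0 0.
pose k := (v^T *m (T^-1 *: mx_integral `[0, T] (psi_along psi x u))) 0 0.
have fE s : f s = (v^T *m psi_along psi x u s) 0 0 - k.
  by rewrite /f mulmxBr mxE [X in _ + X]mxE.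
have cf : {within `[0, T], continuous f}.
  apply: within_continuous_mulmx_coord => s.
  by apply: cvgB; [exact: cpsi|exact: cvg_cst].
have [t tT ft] : exists2 t, 0 <= t <= T & f t != 0.
  apply: contrapT => fn0; move: vn0; apply/negP/negPn/eqP.
  have {}fn0 s : 0 <= s <= T -> (v^T *m psi_along psi x u s) 0 0 = k.
    move=> sT; apply/eqP; rewrite -subr_eq0 -fE; apply/negPn/negP => fs.
    by apply: fn0; exists s.
  (* The sign of the constant value [k] decides whether [v] or [- v] is the normal that contradicts
     E1. *)
  have [k0|k0] := leP 0 k.
    by apply: (condition_E1_ge0 E1) => s /fn0 ->.
  apply/eqP; rewrite -oppr_eq0; apply/eqP.
  apply: (condition_E1_ge0 E1) => s /fn0 sk.
  by rewrite linearN/= mulNmx mxE sk oppr_ge0 ltW.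
rewrite Sigma_mx_quadratic// mulr_gt0 ?invr_gt0//.
apply: (@Rintegral_gt0 _ _ _ t) => //.
- by move=> s; apply: cvgM; exact: cf.
- by move=> s _; exact: sqr_ge0.
- by rewrite exprn_even_gt0.
Qed.

End trajectory.

Theorem proposition3p2 (R : realType) (n m d : nat)
  (F : 'cV[R]_n -> 'cV[R]_m -> R -> 'cV[R]_n)
  (c : 'cV[R]_n -> 'cV[R]_m -> R -> R)
  (psi : 'cV[R]_n -> 'cV[R]_m -> R -> 'cV[R]_d)
  (sigma T : R) (x : R -> 'cV[R]_n) (u : R -> 'cV[R]_m)
  (sigma_gt0 : 0 < sigma) (T_gt0 : 0 < T)
  (c_ge0 : forall (z : 'cV[R]_n) (w : 'cV[R]_m) (t : R), 0 <= t -> 0 <= c z w t)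
  (A1 : assumption_A1 F psi c T)
  (xu : input_state_trajectory F T x u)
  (E1 : condition_E1 psi x u T) :
  (forall v : 'cV[R]_d, E2_inequality psi x u sigma T v <-> v = 0) /\
  positive_definite (Sigma_mx psi x u T).
Proof.
case: A1 => cpsi _ feedback.
have cY := psi_along_continuous cpsi xu.
split; last exact: Sigma_mx_positive_definite.
move=> v; split=> [E2|->]; last exact: E2_inequality0.
apply: (condition_E1_ge0 E1); apply: (E2_inequality_ge0 sigma_gt0) E2 => //.
  exact: ltW.
(* The feedback law of A1 for the parameter [v] supplies the minimisers. *)
move=> z t t0; have [phi [_ minphi _]] := feedback v.
by exists (phi z t); exact: minphi.
Qed.
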